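(* Let $f$ be a closure operator on a finite set $E$. The following are equivalent: (i) the Bergman complex $\widetilde{\Delta}_f$ is shellable; (ii) for every proper flat $F$ of $f$, the Bergman complex $\widetilde{\Delta}_{f/F}$ is shellable; (iii) the augmented Bergman complex $\Delta_f$ admits a shelling order in which the maximal flags (facets containing no vertex $y_i$) appear first and the bases (facets containing no vertex $x_F$) appear last; (iv) the augmented Bergman complex $\Delta_f$ is shellable.
   Context: A closure operator on a finite set $E$ is a map $f:2^E\to 2^E$ with $A\subseteq f(A)$, $A\subseteq B\Rightarrow f(A)\subseteq f(B)$, and $f(f(A))=f(A)$. A flat is a set $F$ with $f(F)=F$; it is proper if $F\ne E$. A set $I\subseteq E$ is independent if $f(I\setminus\{i\})\subsetneq f(I)$ for every $i\in I$; a basis is an independent set with $f(I)=E$. The Bergman complex $\widetilde{\Delta}_f$ has a vertex $x_F$ for each flat $F$ with $f(\emptyset)\subsetneq F\subsetneq E$, and faces $\{x_{F_1},\dots,x_{F_\ell}\}$ for chains of flats $f(\emptyset)\subsetneq F_1\subsetneq\cdots\subsetneq F_\ell\subsetneq E$. The augmented Bergman complex $\Delta_f$ has vertex set $\{y_i\mid i\in E\}\sqcup\{x_F\mid F \text{ a proper flat of } f\}$ (including $F=f(\emptyset)$ if $f(\emptyset)\neq E$), and faces $\{y_i\mid i\in I\}\sqcup\{x_{F_1},\dots,x_{F_\ell}\}$ where $I$ is independent and $f(I)\subseteq F_1\subsetneq\cdots\subsetneq F_\ell\subsetneq E$ are flats ($\ell\ge0$). For a flat $F$, the contraction $f/F:2^{E\setminus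 F}\to 2^{E\setminus F}$ is $(f/F)(A)=f(A\cup F)\setminus F$. A (not necessarily pure) simplicial complex is shellable if its facets can be ordered $\sigma_1,\dots,\sigma_k$ so that for each $2\le i\le k$ the complex $\langle\sigma_1,\dots,\sigma_{i-1}\rangle\cap\langle\sigma_i\rangle$ is pure of dimension $\dim(\sigma_i)-1$, where $\langle\cdot\rangle$ denotes the complex generated by the given faces. *)

(* Defs.v *)
From mathcomp Require Import all_boot all_order all_algebra.

Set Implicit Arguments.
Unset Strict Implicit.
Unset Printing Implicit Defensive.

Import GRing.Theory.

(* A simplicial complex on the vertex type V is given by its set of faces
   K : {set {set V}}, the empty face included. *)
Section Complexes.
Variable V : finType.
Implicit Types (K : {set {set V}}) (s : {set V}) (ss : seq {set V}).

(* dim set0 = -1 *)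
Definition dim s : int := (#|s|%:Z - 1)%R.

Definition facets K : {set {set V}} := [set s | maxset (fun t => t \in K) s].

Definition generated ss : {set {set V}} := \bigcup_(s <- ss) powerset s.

Definition pure_of_dim K (d : int) : Prop :=
  forall s, s \in facets K -> dim s = d.

(* Positions are counted from 0, so that the condition starts at i = 1. *)
Definition shelling_order K ss : Prop :=
  [/\ uniq ss, ss =i facets K &
      forall i, 0 < i < size ss ->
        pure_of_dim
          (generated (take i ss) :&: generated [:: nth set0 ss i])
          (dim (nth set0 ss i) - 1)%R].

Definition shellable K : Prop := exists ss, shelling_order K ss.

End Complexes.

Section ClosureOperators.
Variable T : finType.
Implicit Types (f : {set T} -> {set T}) (A B F I : {set T}).
Implicit Type C : {set {set T}}.

Definition closure_operator f : Prop :=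
  [/\ forall A, A \subset f A,
      forall A B, A \subset B -> f A \subset f B &
      forall A, f (f A) = f A].

Definition flat f F : bool := f F == F.

Definition proper_flat f F : bool := flat f F && (F != [set: T]).

Definition independent f I : bool :=
  [forall i in I, f (I :\ i) \proper f I].

Definition chain C : bool :=
  [forall F in C, forall G in C, (F \subset G) || (G \subset F)].

Definition bergman f : {set {set {set T}}} :=
  [set C | chain C
         & [forall F in C, proper_flat f F && (f set0 \proper F)]].

(* The vertex y_i is inl i and the vertex x_F is inr F. *)
Definition y_part (s : {set T + {set T}}) : {set T} := inl @^-1: s.
Definition x_part (s : {set T + {set T}}) : {set {set T}} := inr @^-1: s.

Definition augmented_bergman f : {set {set T + {set T}}} :=
  [set s | [&& independent f (y_part s), chain (x_part s) &
            [forall F in x_part s,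
               proper_flat f F && (f (y_part s) \subset F)]]].

(* In a list of facets satisfying this condition, those without a vertex y_i
   form an initial segment and those without a vertex x_F a final segment. *)
Definition flags_first_bases_last (ss : seq {set T + {set T}}) : bool :=
  pairwise (fun s t => ((y_part t == set0) ==> (y_part s == set0))
                    && ((x_part s == set0) ==> (x_part t == set0))) ss.

(* The ground set of f / F is the subtype of elements outside F, so that
   removing F from f (A :|: F) amounts to taking the preimage under val. *)
Definition contraction f F (A : {set {x : T | x \notin F}}) :
    {set {x : T | x \notin F}} :=
  val @^-1: f ((val @: A) :|: F).

End ClosureOperators.

(* Main.v *)
(** Shellability is equivalent to the existence of a rank function on the facets
    such that any two distinct facets [a], [b] with [r b <= r a] admit a facet
    [c] of smaller rank than [a] which meets [a] in [a] minus one vertex and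
    contains the intersection of [a] and [b]. Such ranks restrict to links.
    The Bergman complex of f/F is the link of a maximal chain of flats in
    (f(set0), F], and the Bergman complex of f is the link of the vertex
    x_{f(set0)} in the augmented complex.

    Conversely, a facet of the augmented complex is an independent set I with,
    when f(I) <> E, the flat f(I) and a facet of the complex of chains strictly
    above f(I). Ordering the facets by I first (along any linear extension of
    inclusion with the bases last), and then by a shelling above f(I), is a
    shelling: if I is not contained in J, one removes y_i for some i in I \ J
    and extends the chain downwards to f(I \ i). *)
Require Import Defs.
From mathcomp Require Import all_boot all_order all_algebra.

Set Implicit Arguments.
Unset Strict Implicit.
Unset Printing Implicit Defensive.

(** * Shelling orders, rank functions on facets, and links *)

Section Shellings.
Variable V : finType.
Implicit Types (K : {set {set V}}) (a b c s t : {set V}) (ss : seq {set V}).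

Lemma facetsP K s :
  reflect (s \in K /\ forall t, t \in K -> s \subset t -> t = s)
          (s \in facets K).
Proof. by rewrite inE; apply: maxsetP. Qed.

Lemma facet_exists K s :
  s \in K -> exists2 t, t \in facets K & s \subset t.
Proof.
move=> sK; have [t tmax st] := maxset_exists (P := fun t => t \in K) sK.
by exists t; rewrite ?inE.
Qed.

Lemma generatedP ss s :
  reflect (exists2 t, t \in ss & s \subset t) (s \in generated ss).
Proof.
suff -> : (s \in generated ss) = has (fun t => s \subset t) ss by apply: hasP.
rewrite /generated; elim: ss => [|t ss IH]; first by rewrite big_nil inE.
by rewrite big_cons inE IH powersetE.
Qed.

(** The local form of the shelling condition, in which [P] selects the facets regarded as earlier
    than [a]. *)
Definition shelling_step (P : pred {set V}) a b : Prop :=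
  exists c x, [/\ P c, x \in a, a :&: c = a :\ x & a :&: b \subset c].

(** A facet of the intersection has the form [a :&: c] with [c] in [ss], so purity means that each
    [a :&: b] lies in such a face missing exactly one vertex of [a]. *)
Lemma pure_shelling_step ss a : a \notin generated ss ->
  pure_of_dim (generated ss :&: generated [:: a]) (Defs.dim a - 1)%R <->
  forall b, b \in ss -> shelling_step (mem ss) a b.
Proof.
move=> aNss; have memI t : (t \in generated ss :&: generated [:: a]) =
    (t \in generated ss) && (t \subset a).
  by rewrite inE; congr andb; rewrite /generated big_seq1 powersetE.
split=> [pure b bss|step m /facetsP[]].
  have: a :&: b \in generated ss :&: generated [:: a].
    by rewrite memI subsetIl andbT; apply/generatedP; exists b; rewrite ?subsetIr.
  case/facet_exists=> m mF abm; have [] := facetsP _ _ mF.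
  rewrite memI => /andP[/generatedP[c css mc] ma] mmax.
  have acE : a :&: c = m.
    apply: mmax; last by rewrite subsetI ma.
    by rewrite memI subsetIl andbT; apply/generatedP; exists c; rewrite ?subsetIr.
  have card_m : #|a :\: m| = 1.
    have := pure _ mF; rewrite /Defs.dim cardsDS // => /GRing.addIr.
    move=> mE; have: (#|m|%:Z + 1 = #|a|%:Z)%R by rewrite mE GRing.subrK.
    by rewrite -PoszD => -[<-]; rewrite addKn.
  have /cards1P[x amE] : #|a :\: m| == 1 by rewrite card_m.
  have xa : x \in a.
    by have: x \in a :\: m; [rewrite amE set11 | case/setDP].
  exists c, x; split=> //; last by rewrite (subset_trans abm).
  by rewrite acE -amE setDDr setDv set0U; apply/esym/setIidPr.
rewrite memI => /andP[/generatedP[b bss mb] ma] mmax.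
have [c [x [css xa acE abc]]] := step b bss.
have: a :&: c = m.
  apply: mmax.
    by rewrite memI subsetIl andbT; apply/generatedP; exists c; rewrite ?subsetIr.
  by rewrite subsetI ma (subset_trans _ abc) // subsetI ma.
move<-; rewrite acE /Defs.dim (cardsD1 x a) xa PoszD.
by rewrite [X in (X - 1 - 1)%R]GRing.addrC GRing.addrK.
Qed.

(* Ties in the rank may be broken arbitrarily, because the facet [c] in the step
   has strictly smaller rank than [a]. *)
Definition shelling_rank K (r : {set V} -> nat) : Prop :=
  {in facets K &, forall a b, a != b -> r b <= r a ->
     shelling_step [pred c in facets K | r c < r a] a b}.

Lemma facet_notin_generated K ss a :
  a \in facets K -> {subset ss <= facets K} -> a \notin ss ->
  a \notin generated ss.
Proof.
case/facetsP=> aK amax ssK; apply: contra => /generatedP[t tss at_].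
by rewrite -(amax t) //; case/facetsP: (ssK _ tss).
Qed.

Lemma shelling_order_sort K r : shelling_rank K r ->
  shelling_order K (sort (relpre r leq) (enum (facets K))).
Proof.
move=> rK; set ss := sort _ _.
have ss_uniq : uniq ss by rewrite sort_uniq enum_uniq.
have mem_ss : ss =i facets K by move=> s; rewrite mem_sort mem_enum.
have ss_sorted : sorted (relpre r leq) ss.
  by apply: sort_sorted => s t; apply: leq_total.
have r_mono := sorted_leq_nth (fun _ _ _ => @leq_trans _ _ _)
  (fun _ => leqnn _) set0 ss_sorted.
split=> // i /andP[i_gt0 i_lt]; set a := nth set0 ss i.
have aF : a \in facets K by rewrite -mem_ss mem_nth.
have takeF : {subset take i ss <= facets K}.
  by move=> s /mem_take; rewrite mem_ss.
have aNtake : a \notin take i ss.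
  by rewrite in_take ?mem_nth // index_uniq // ltnn.
apply/pure_shelling_step; first exact: facet_notin_generated aF takeF aNtake.
move=> b bi; have bss := mem_take bi.
have rba : r b <= r a.
  have := bi; rewrite in_take // => lt_i; have := r_mono (index b ss) i.
  by rewrite /= nth_index // !inE; apply; rewrite ?index_mem // ltnW.
have ab : a != b by apply: contraNneq aNtake => ->.
have [c [x [/andP[cF rca] xa acE abc]]] := rK a b aF (takeF _ bi) ab rba.
exists c, x; split=> //; have css : c \in ss by rewrite mem_ss.
(* The strict inequality of ranks forces [c] before position [i]: from [i] on, ranks are at least
   [r a]. *)
rewrite inE /= in_take // ltnNge; apply: contraL rca => le_i; rewrite -leqNgt.
by have := r_mono i (index c ss); rewrite /= nth_index // !inE; apply;
  rewrite ?index_mem.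
Qed.

Lemma shelling_rank_index K ss :
  shelling_order K ss -> shelling_rank K (index^~ ss).
Proof.
case=> ss_uniq mem_ss pure a b aF bF ab; rewrite leq_eqVlt.
rewrite -!mem_ss in aF bF *; case/predU1P=> [eq_ab|lt_ba].
  by rewrite -(nth_index set0 aF) -eq_ab nth_index ?eqxx in ab.
have i_lt : index a ss < size ss by rewrite index_mem.
have := pure (index a ss); rewrite nth_index //.
rewrite (leq_ltn_trans _ lt_ba) // => /(_ i_lt).
have takeF : {subset take (index a ss) ss <= facets K}.
  by move=> s /mem_take; rewrite mem_ss.
have aN : a \notin take (index a ss) ss by rewrite in_take ?ltnn.
have aNgen : a \notin generated (take (index a ss) ss).
  by apply: facet_notin_generated takeF aN; rewrite -mem_ss.
move=> /(pure_shelling_step aNgen)/(_ b); rewrite in_take //.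
move=> /(_ lt_ba)[c [x [ci xa acE abc]]].
exists c, x; split=> //; have css := mem_take ci.
by rewrite inE /= in_take // in ci; rewrite /= -mem_ss css.
Qed.

Lemma shellableP K : shellable K <-> exists r, shelling_rank K r.
Proof.
split=> [[ss /shelling_rank_index rK]|[r /shelling_order_sort ssK]].
  by exists (index^~ ss).
by eexists; apply: ssK.
Qed.

End Shellings.

(** Here [h] identifies [L] with the link of [tau] in [K]. A rank on the facets of [K] is pulled
    back along [tau :|: h @: t], which maps facets of [L] to facets of [K]. *)
Lemma shellable_link (V W : finType) (K : {set {set V}}) (L : {set {set W}})
    (h : W -> V) (tau : {set V}) :
    {in cover L &, injective h} ->
    {in L, forall t : {set W}, [disjoint tau & h @: t]} ->
    {in L, forall t : {set W}, tau :|: h @: t \in K} ->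
    (forall s, s \in K -> tau \subset s ->
       exists2 t, t \in L & s = tau :|: h @: t) ->
  shellable K -> shellable L.
Proof.
move=> h_inj tauh LK KL /shellableP[r rK]; apply/shellableP.
pose phi (t : {set W}) := tau :|: h @: t; exists (r \o phi).
have mem_phi a t x : a \in L -> t \in L -> x \in a -> (h x \in phi t) = (x \in t).
  move=> aL tL xa; rewrite inE (disjointFl (tauh a aL) (imset_f h xa)) /=.
  apply/idP/idP  => [/imsetP[y yt /h_inj->//]|]; last exact: imset_f.
    by apply/bigcupP; exists a.
  by apply/bigcupP; exists t.
have phiS a t : a \in L -> t \in L -> phi a \subset phi t -> a \subset t.
  move=> aL tL sat; apply/subsetP => x xa; rewrite -(mem_phi a) //.
  by apply: (subsetP sat); rewrite !inE imset_f ?orbT.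
have phi_inj : {in L &, injective phi}.
  by move=> a t aL tL pat; apply/eqP; rewrite eqEsubset !phiS ?pat.
have phiF a : a \in facets L -> phi a \in facets K.
  case/facetsP=> aL amax; apply/facetsP; split=> [|s sK as_]; first exact: LK.
  have [t tL sE] := KL s sK (subset_trans (subsetUl _ _) as_).
  by rewrite -/(phi t) in sE; rewrite sE (amax t tL) // phiS // -sE.
move=> a b aF bF ab rba; have [[aL _] [bL _]] := (facetsP _ _ aF, facetsP _ _ bF).
have phi_ab : phi a != phi b by apply: contraNneq ab => /phi_inj->.
have [c' [x' [/andP[/= c'F rca] x'a acE abc]]] :=
  rK _ _ (phiF a aF) (phiF b bF) phi_ab rba.
have [c'K c'max] := facetsP _ _ c'F.
(* The facet [c'] contains [tau], because both [phi a] and [phi b] do; so it comes from [L]. *)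
have [|c cL c'E] := KL c' c'K.
  by apply: subset_trans abc; rewrite subsetI !subsetUl.
rewrite -/(phi c) in c'E; subst c'.
have cF : c \in facets L.
  apply/facetsP; split=> // t tL ct; apply/phi_inj => //.
  by apply: c'max; [exact: LK | exact/setUS/imsetS].
have x'c : x' \notin phi c.
  by move/setP/(_ x'): acE; rewrite in_setI in_setD1 eqxx x'a /= => ->.
(* The removed vertex is outside [phi c], hence outside [tau]. *)
have [x xa x'E] : exists2 x, x \in a & x' = h x.
  by apply/imsetP; move: x'a x'c; rewrite !inE; case: (x' \in tau).
subst x'; exists c, x; split=> //; first by apply/andP.
  apply/setP => y; rewrite !inE andbC.
  have [ya|] := boolP (y \in a); rewrite ?andbF // !andbT.
  move/setP/(_ (h y)): acE.
  rewrite in_setI in_setD1 !(mem_phi a) // ya andbT /= => ->.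
  by rewrite (inj_in_eq h_inj) //; apply/bigcupP; exists a.
apply/subsetP => y /setIP[ya yb]; rewrite -(mem_phi a) //; apply: (subsetP abc).
by rewrite inE !(mem_phi a) // ya.
Qed.

(** * Chains of sets *)

Section Chains.
Variable U : finType.
Implicit Types (F G : {set U}) (C D : {set {set U}}).

Lemma chainP C :
  reflect {in C &, forall F G, (F \subset G) || (G \subset F)} (chain C).
Proof.
apply: (iffP forall_inP) => [CC F G FC GC|CC F FC].
  exact: (forall_inP (CC F FC)).
by apply/forall_inP => G; apply: CC.
Qed.

Lemma chainS C D : C \subset D -> chain D -> chain C.
Proof.
by move=> /subsetP CD /chainP DD; apply/chainP => F G /CD FD /CD; apply: DD.
Qed.

Lemma chainU1 F C : chain C ->
  {in C, forall G, (F \subset G) || (G \subset F)} -> chain (F |: C).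
Proof.
move=> /chainP CC FC; apply/chainP => G H /setU1P[->|GC] /setU1P[->|HC].
- by rewrite subxx.
- exact: FC.
- by rewrite orbC FC.
- exact: CC.
Qed.

End Chains.

(** * Chains of flats above a flat, and contractions *)

Section ClosureComplexes.
Variables (T : finType) (f : {set T} -> {set T}).
Hypothesis f_closure : closure_operator f.
Implicit Types (A B F G I J : {set T}) (C D : {set {set T}}).

Let sub_f A : A \subset f A. Proof. by case: f_closure. Qed.
Let fS A B : A \subset B -> f A \subset f B.
Proof. by case: f_closure => _ + _; apply. Qed.
Let ff A : f (f A) = f A. Proof. by case: f_closure. Qed.

(** A model of the Bergman complex of [f/F] inside the original ground set; at [f set0] it is
    [bergman f] by conversion. *)
Definition upper_complex F : {set {set {set T}}} :=
  [set C | chain C & [forall G in C, proper_flat f G && (F \proper G)]].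

Lemma upperP F C :
  reflect (chain C /\ {in C, forall G, proper_flat f G /\ F \proper G})
          (C \in upper_complex F).
Proof.
rewrite inE; apply: (iffP andP) => -[CC CF]; split=> //.
  by move=> G GC; apply/andP; apply: (forall_inP CF).
by apply/forall_inP => G /CF[-> ->].
Qed.

Section Contraction.
Variable F : {set T}.
Hypothesis F_flat : flat f F.

Implicit Types (P Q : {set {x | x \notin F}}).

(** With [unlift], this is the bijection between subsets of the ground set of [f/F] and subsets of
    [T] containing [F]. *)
Definition lift (A : {set {x | x \notin F}}) : {set T} := val @: A :|: F.

Definition unlift (G : {set T}) : {set {x | x \notin F}} := val @^-1: G.

Lemma mem_lift P x : (val x \in lift P) = (x \in P).
Proof.
by rewrite inE (negPf (valP x)) orbF mem_imset //; apply: val_inj.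
Qed.

Lemma liftK : cancel lift unlift.
Proof. by move=> P; apply/setP => x; rewrite inE mem_lift. Qed.

Lemma lift_inj : injective lift.
Proof. exact: can_inj liftK. Qed.

Lemma unliftK G : F \subset G -> lift (unlift G) = G.
Proof.
move=> FG; apply/setP => x; rewrite inE.
have [xF|xF] := boolP (x \in F); first by rewrite orbT (subsetP FG).
rewrite orbF; apply/imsetP/idP => [[y + ->]|xG]; first by rewrite inE.
by exists (Sub x xF); rewrite ?inE SubK.
Qed.

Lemma liftS P Q : (lift P \subset lift Q) = (P \subset Q).
Proof.
apply/idP/idP => PQ; last exact/setSU/imsetS.
by apply/subsetP => x; rewrite -!mem_lift; apply: (subsetP PQ).
Qed.

(** Under [lift] the contraction becomes [f] itself, and its closure of the empty set is empty
    because [F] is a flat. *)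
Lemma contraction_vertex P :
  proper_flat (@contraction T f F) P && (@contraction T f F set0 \proper P) =
  proper_flat f (lift P) && (F \proper lift P).
Proof.
have lift0 : lift set0 = F by rewrite /lift imset0 set0U.
have liftT : lift setT = setT.
  by rewrite -[RHS](unliftK (subsetT F)) /unlift preimsetT.
have contractionE Q : contraction f Q = unlift (f (lift Q)) by [].
have -> : contraction f set0 = set0 :> {set {x | x \notin F}}.
  by rewrite contractionE lift0 (eqP F_flat) -[X in unlift X]lift0 liftK.
congr (_ && _); last by rewrite !properE -!liftS lift0.
rewrite /proper_flat /flat -!(inj_eq lift_inj) liftT contractionE; congr (_ && _).
by rewrite unliftK // (subset_trans _ (sub_f _)) ?subsetUr.
Qed.

Lemma upper_lift (D : {set {set {x | x \notin F}}}) :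
  D \in bergman (@contraction T f F) -> lift @: D \in upper_complex F.
Proof.
rewrite inE => /andP[/chainP DD DF]; apply/upperP; split.
  by apply/chainP => _ _ /imsetP[G GD ->] /imsetP[H HD ->]; rewrite !liftS DD.
move=> _ /imsetP[G GD ->]; apply/andP.
by rewrite -contraction_vertex (forall_inP DF).
Qed.

Lemma bergman_unlift C : C \in upper_complex F ->
  unlift @: C \in bergman (@contraction T f F).
Proof.
case/upperP=> /chainP CC CF; rewrite inE; apply/andP; split.
  apply/chainP => _ _ /imsetP[G GC ->] /imsetP[H HC ->].
  by case/orP: (CC G H GC HC) => GH; rewrite ?(preimsetS _ GH) ?orbT.
apply/forall_inP => _ /imsetP[G /CF[GF FG] ->].
by rewrite contraction_vertex unliftK ?GF // proper_sub.
Qed.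

(** The two complexes are isomorphic through [lift] and [unlift]; an isomorphism is treated as a
    link of the empty face. *)
Lemma shellable_contraction :
  shellable (bergman (@contraction T f F)) <-> shellable (upper_complex F).
Proof.
split.
  apply: (@shellable_link _ _ _ _ unlift set0).
  - move=> G H /bigcupP[C /upperP[_ CF] /CF[_ /proper_sub FG]].
    move=> /bigcupP[D /upperP[_ DF] /DF[_ /proper_sub FH]] GH.
    by rewrite -(unliftK FG) GH unliftK.
  - by move=> C _; rewrite disjoints_subset sub0set.
  - by move=> C /bergman_unlift; rewrite set0U.
  - move=> D DB _; exists (lift @: D); first exact: upper_lift.
    rewrite set0U -imset_comp -[LHS]imset_id; apply: eq_imset => P /=.
    by rewrite liftK.
apply: (@shellable_link _ _ _ _ lift set0).
- by move=> P Q _ _; apply: lift_inj.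
- by move=> C _; rewrite disjoints_subset sub0set.
- by move=> C /upper_lift; rewrite set0U.
- move=> C CU _; exists (unlift @: C); first exact: bergman_unlift.
  rewrite set0U -imset_comp -[LHS]imset_id; apply: eq_in_imset => G GC /=.
  by rewrite unliftK //; case/upperP: CU => _ /(_ G GC)[_ /proper_sub].
Qed.

End Contraction.

Lemma shellable_upper F :
  shellable (bergman f) -> proper_flat f F -> shellable (upper_complex F).
Proof.
move=> bergman_sh F_proper; have [F_flat _] := andP F_proper.
pose below (C : {set {set T}}) := (C \in bergman f) && [forall G in C, G \subset F].
have below0 : below set0.
  rewrite /below inE; apply/andP; split; last by apply/forall_inP => G; rewrite inE.
  by apply/andP; split; [apply/chainP | apply/forall_inP] => G; rewrite inE.
(* [C] is a maximal chain of flats in the interval from [f set0], excluded, to [F], included. *)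
have [C /maxsetP[/andP[CB /forall_inP CF] Cmax] _] := maxset_exists below0.
have {}CB : C \in upper_complex (f set0) by [].
have fF G : flat f G -> f set0 \subset G by move=> /eqP <-; apply/fS/sub0set.
(* Maximality of [C] forces every other member of a chain containing [C] to lie
   strictly above [F]. *)
have above D : D \in upper_complex (f set0) -> C \subset D ->
    {in D :\: C, forall G, F \proper G}.
  case/upperP=> DD DF CD G /setDP[GD GNC].
  have GNF : ~~ (G \subset F).
    apply: contra GNC => GF; rewrite -(Cmax (G |: C)) ?setU11 ?subsetU1 //.
    apply/andP; split.
      apply/upperP; split.
        by apply: (chainS _ DD); rewrite subUset sub1set GD.
      by move=> H /setU1P[->|HC]; apply: DF => //; apply: (subsetP CD).
    by apply/forall_inP => H /setU1P[->|/CF].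
  (* Unless it is the bottom flat, [F] is itself in [C] by maximality, being comparable to every
     member of [C]. *)
  have [FG0|FD] : F = f set0 \/ F \in D.
    have [->|F0] := eqVneq F (f set0); [by left | right].
    apply: (subsetP CD); rewrite -(Cmax (F |: C)) ?setU11 ?subsetU1 //.
    have f0F : f set0 \proper F by rewrite properEneq eq_sym F0 fF.
    have [CC CV] := upperP _ _ CB.
    apply/andP; split; last by apply/forall_inP => H /setU1P[->|/CF].
    apply/upperP; split.
      by apply: chainU1 => // H HC; rewrite CF ?orbT.
    by move=> H /setU1P[->|/CV].
  - by rewrite FG0; case: (DF G GD).
  - by rewrite properE; case/orP: (chainP _ DD F G FD GD) GNF => ->.
move: bergman_sh; apply: (@shellable_link _ _ _ _ id C).
- by move=> ? ? _ _.
- move=> D /upperP[_ DF]; rewrite imset_id disjoints_subset.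
  apply/subsetP => G GC; rewrite inE; apply/negP => /DF[_].
  by rewrite properE CF ?andbF.
- move=> D /upperP[DD DF]; rewrite imset_id; have [CC CV] := upperP _ _ CB.
  apply/upperP; split; last first.
    move=> G /setUP[/CV//|/DF[Gp FG]]; split=> //.
    by apply: sub_proper_trans FG; apply: fF.
  apply/chainP => G H /setUP[GC|GD] /setUP[HC|HD].
  + exact: (chainP _ CC).
  + by rewrite (subset_trans (CF _ GC)) // proper_sub //; case: (DF H HD).
  + by rewrite orbC (subset_trans (CF _ HC)) // proper_sub //; case: (DF G GD).
  + exact: (chainP _ DD).
- move=> D DB CD; exists (D :\: C); last first.
    by rewrite imset_id setDE setUIr setUCr setIT; apply/esym/setUidPr.
  have [DD DV] := upperP _ _ DB; apply/upperP; split.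
    by apply: (chainS _ DD); apply: subsetDl.
  by move=> G GDC; split; [case/setDP: GDC => /DV[] | exact: above GDC].
Qed.

(** * Faces and facets of the augmented Bergman complex *)

Definition face I C : {set T + {set T}} := inl @: I :|: inr @: C.

Lemma mem_facel I C i : (inl i \in face I C) = (i \in I).
Proof.
rewrite inE mem_imset; last by move=> ? ? [].
by case: imsetP => [[]|]; rewrite // orbF.
Qed.

Lemma mem_facer I C F : (inr F \in face I C) = (F \in C).
Proof.
rewrite inE (mem_imset C); last by move=> ? ? [].
by case: imsetP => [[]|].
Qed.

Lemma y_part_face I C : y_part (face I C) = I.
Proof. by apply/setP => i; rewrite inE mem_facel. Qed.

Lemma x_part_face I C : x_part (face I C) = C.
Proof. by apply/setP => i; rewrite inE mem_facer. Qed.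

Lemma face_parts (s : {set T + {set T}}) : face (y_part s) (x_part s) = s.
Proof. by apply/setP => -[i|F]; rewrite (mem_facel, mem_facer) inE. Qed.

Lemma faceS I C J D : (face I C \subset face J D) = (I \subset J) && (C \subset D).
Proof.
apply/idP/andP => [IJ|[IJ CD]]; last by rewrite setUSS ?imsetS.
split; apply/subsetP => z zI; [rewrite -(mem_facel J D)|rewrite -(mem_facer J D)].
  by apply: (subsetP IJ); rewrite mem_facel.
by apply: (subsetP IJ); rewrite mem_facer.
Qed.

Lemma faceI I C J D : face I C :&: face J D = face (I :&: J) (C :&: D).
Proof. by apply/setP => -[i|F]; rewrite in_setI ?mem_facel ?mem_facer inE. Qed.

Lemma augmented_bergmanP I C :
  reflect [/\ independent f I, chain C &
             {in C, forall F, proper_flat f F /\ f I \subset F}]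
          (face I C \in augmented_bergman f).
Proof.
rewrite inE y_part_face x_part_face; apply: (iffP and3P) => -[If CC CF]; split=> //.
  by move=> F FC; apply/andP; apply: (forall_inP CF).
by apply/forall_inP => F /CF[-> ->].
Qed.

(** If [j] were redundant in [I :\ i], it would lie in [f (I :\ j)] by monotonicity, and so be
    redundant in [I]. *)
Lemma independentD1 I i : independent f I -> independent f (I :\ i).
Proof.
move=> /forall_inP If; apply/forall_inP => j /setD1P[ji jI].
have := If j jI; rewrite properE => /andP[_].
rewrite properE [X in _ -> X && _]fS ?subD1set //=; apply: contra => fIj.
have jf : j \in f (I :\ i :\ j).
  apply: (subsetP fIj); apply: (subsetP (sub_f _)).
  by rewrite !inE ji.
have jf' : j \in f (I :\ j).
  by apply: (subsetP (fS _)) jf; apply: setSD; apply: subD1set.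
rewrite -[f (I :\ j)]ff; apply: fS; apply/subsetP => z zI.
have [->//|zj] := eqVneq z j.
by apply: (subsetP (sub_f _)); rewrite !inE zj.
Qed.

(** An element of [J] outside [I] would be redundant in [J]. This fixes the y-part of any face that
    contains a given face with the vertex [f I]. *)
Lemma independent_span_inj I J :
  independent f J -> I \subset J -> f J \subset f I -> J = I.
Proof.
move=> /forall_inP Jf IJ fJI; apply/eqP; rewrite eqEsubset IJ andbT.
apply/subsetP => j jJ; apply: contraT => jI.
have := Jf j jJ; rewrite properE => /andP[_ /negP[]].
by apply: subset_trans fJI _; apply: fS; rewrite subsetD1 IJ.
Qed.

Lemma independentS I J : I \proper J -> independent f J -> f I \proper f J.
Proof.
move=> /properP[IJ [j jJ jI]] /forall_inP/(_ j jJ); apply: sub_proper_trans.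
by apply: fS; rewrite subsetD1 IJ.
Qed.

Lemma upper_facet_face I C :
    independent f I -> f I != setT -> C \in facets (upper_complex (f I)) ->
  face I (f I |: C) \in facets (augmented_bergman f).
Proof.
move=> If fIT /facetsP[/upperP[CC CF] Cmax]; apply/facetsP; split.
  apply/augmented_bergmanP; split=> //.
    by apply: chainU1 => // G /CF[_ /proper_sub->].
  move=> F /setU1P[->|/CF[Fp /proper_sub//]]; split=> //.
  by rewrite /proper_flat /flat ff eqxx.
move=> s; rewrite -(face_parts s); move: (y_part s) (x_part s) => J D.
move=> /augmented_bergmanP[Jf DD DF]; rewrite faceS subUset sub1set.
case/and3P=> IJ fID CD; have [_ fJI] := DF _ fID.
have JI := independent_span_inj Jf IJ fJI; subst J; congr face.
rewrite -(Cmax (D :\ f I)) ?setD1K //.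
  apply/upperP; split; first by apply: (chainS _ DD); apply: subD1set.
  by move=> G /setD1P[GI /DF[Gp fIG]]; rewrite properEneq eq_sym GI.
by rewrite subsetD1 CD /=; apply/negP => /CF[_]; rewrite properxx.
Qed.

(** When [f I] is proper, it can be adjoined to any face with y-part [I], so a maximal face already
    contains it; when [f I] is everything, no proper flat lies above it. *)
Lemma facet_face s : s \in facets (augmented_bergman f) ->
  exists I C, [/\ s = face I C, independent f I &
    if f I == setT then C = set0
    else f I \in C /\ C :\ f I \in facets (upper_complex (f I))].
Proof.
rewrite -{1 2}(face_parts s); move: (y_part s) (x_part s) => I C.
case/facetsP=> /augmented_bergmanP[If CC CF] smax; exists I, C; split=> //.
case: eqP => [fIT|/eqP fIT].
  apply/setP => G; rewrite inE; apply/negP => /CF[/andP[_ GT]].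
  by rewrite fIT subTset (negPf GT).
have fIp : proper_flat f (f I) by rewrite /proper_flat /flat ff eqxx.
have upper_face D : D \in upper_complex (f I) ->
    face I (f I |: D) \in augmented_bergman f.
  case/upperP=> DD DF; apply/augmented_bergmanP; split=> //.
    by apply: chainU1 => // G /DF[_ /proper_sub->].
  by move=> G /setU1P[->|/DF[Gp /proper_sub]].
have CU : C :\ f I \in upper_complex (f I).
  apply/upperP; split; first by apply: (chainS _ CC); apply: subD1set.
  by move=> G /setD1P[GI /CF[Gp fIG]]; rewrite properEneq eq_sym GI.
have maxC D : D \in upper_complex (f I) -> C :\ f I \subset D -> f I |: D = C.
  move=> DU CD; rewrite -(x_part_face I (_ |: _)) (smax _ (upper_face _ DU)).
    by rewrite x_part_face.
  by rewrite faceS subxx -subDset.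
have CE := maxC _ CU (subxx _).
have fIC : f I \in C by rewrite -CE setU11.
split=> //; apply/facetsP; split=> // D DU CD.
rewrite -(maxC _ DU CD) setU1K //.
by case/upperP: DU => _ DF; apply/negP => /DF[_]; rewrite properxx.
Qed.

(** * Shellability of the augmented Bergman complex *)

(* The second summand puts the spanning sets last, since [#|I| < #|T|.+1]. *)
Definition basis_rank I : nat := #|I| + (f I == setT) * #|T|.+1.

Lemma basis_rank_proper I J :
  independent f J -> I \proper J -> basis_rank I < basis_rank J.
Proof.
move=> Jf IJ; rewrite /basis_rank.
(* A proper subset of an independent set never spans. *)
have -> : f I == setT = false.
  apply/eqP => fIT; have := independentS IJ Jf.
  by rewrite fIT properE subsetT subTset andbC.
by rewrite mul0n addn0 (leq_trans (proper_card IJ)) // leq_addr.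
Qed.

(** Facets are ranked lexicographically, by [basis_rank] of the y-part and then by a rank above its
    closure. The second conclusion is what later puts the flags first and the bases last. *)
Lemma augmented_shelling_rank :
    (forall F, proper_flat f F -> shellable (upper_complex F)) ->
  exists2 r, shelling_rank (augmented_bergman f) r &
    forall s t, r s <= r t -> basis_rank (y_part s) <= basis_rank (y_part t).
Proof.
move=> upper_sh.
have: forall I, exists r, f I != setT -> shelling_rank (upper_complex (f I)) r.
  (* The zero rank for spanning sets is a dummy value. *)
  move=> I; have [fIT|fIT] := eqVneq (f I) setT; first by exists (fun=> 0).
  have /shellableP[r rI] : shellable (upper_complex (f I)).
    by apply: upper_sh; rewrite /proper_flat /flat ff eqxx.
  by exists r.
case/fin_all_exists => r rP.
(* Strictly above all values of [r], so that [rk] compares [basis_rank] first. *)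
pose M := (\max_I \max_C r I C).+1.
have rM I C : r I C < M.
  rewrite ltnS (leq_trans (leq_bigmax C)) //.
  exact: (leq_bigmax (F := fun I => \max_C r I C) I).
pose rk I C := basis_rank I * M + r I (C :\ f I).
have rk_lt I C J D : basis_rank I < basis_rank J -> rk I C < rk J D.
  move=> IJ; apply: (@leq_trans ((basis_rank I).+1 * M)).
    by rewrite /rk mulSn addnC ltn_add2r.
  by rewrite (leq_trans _ (leq_addr _ _)) // leq_mul2r IJ orbT.
have rk_le I C J D : rk I C <= rk J D -> basis_rank I <= basis_rank J.
  by move=> IJ; rewrite leqNgt; apply: contraL IJ => /rk_lt lt; rewrite -ltnNge lt.
exists (fun s => rk (y_part s) (x_part s)); last by move=> s t /rk_le.
move=> a b aF bF ab; have [I [C [aE If CP]]] := facet_face aF.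
have [J [D [bE Jf DP]]] := facet_face bF; subst a b.
rewrite !y_part_face !x_part_face => rba.
(* With equal y-parts, the step is the one given by the shelling above [f I]. *)
have [JI|JI] := eqVneq J I.
  subst J; case: ifPn CP DP => [_ C0 D0|fIT [fIC CF] [fID DF]].
    by rewrite C0 D0 eqxx in ab.
  have CD : C :\ f I != D :\ f I.
    apply: contraNneq ab => CD.
    by rewrite -(setD1K fIC) CD setD1K.
  rewrite leq_add2l in rba.
  have [B [x [/andP[/= BF rB] xC CB CDB]]] := rP I fIT _ _ CF DF CD rba.
  have xfI : x != f I by case/setD1P: xC.
  have fIB : f I \notin B.
    have [/upperP[_ BU] _] := facetsP _ _ BF.
    by apply/negP => /BU[_]; rewrite properxx.
  exists (face I (f I |: B)), (inr x); split.
  - apply/andP; split; first exact: upper_facet_face.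
    by rewrite /= y_part_face x_part_face ltn_add2l setU1K.
  - by rewrite mem_facer; case/setD1P: xC.
  - rewrite faceI setIid; apply/setP => -[i|G].
      by rewrite in_setD1 !mem_facel.
    rewrite in_setD1 !mem_facer -{1 2}(setD1K fIC) -setUIr CB !inE.
    (* The function [g] is a left inverse of [inr]; [x] is only its default value on the vertices
       [inl]. *)
    rewrite (inj_eq (can_inj (g := fun z => if z is inr y then y else x) _)) //.
    by have [->|] //= := eqVneq G (f I); rewrite eq_sym xfI.
  - rewrite faceI setIid faceS subxx /=.
    by rewrite -(setD1K fIC) -(setD1K fID) -setUIr setUS.
(* A proper inclusion of [I] in [J] would give [b] a larger rank than [a]. *)
have /subsetPn[i iI iJ] : ~~ (I \subset J).
  apply: contraL (rk_le _ _ _ _ rba) => IJ; rewrite -ltnNge.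
  by apply: basis_rank_proper; rewrite // properEneq eq_sym JI.
pose I' := I :\ i; have I'f : independent f I' := independentD1 i If.
have fI' : f I' \proper f I by apply: (forall_inP If).
have fI'T : f I' != setT by rewrite -properT (proper_sub_trans fI') ?subsetT.
(* All flats of [C] contain [f I], hence lie strictly above [f I']; so [C] extends to a facet [B]
   there. *)
have CI' : C \in upper_complex (f I').
  have [/augmented_bergmanP[_ CC CV] _] := facetsP _ _ aF.
  apply/upperP; split=> // G /CV[Gp fIG]; split=> //.
  exact: proper_sub_trans fIG.
have [B BF CB] := facet_exists CI'.
exists (face I' (f I' |: B)), (inl i); split.
- apply/andP; split; first exact: upper_facet_face.
  rewrite /= y_part_face x_part_face; apply: rk_lt.
  by apply: basis_rank_proper; rewrite ?properD1.
- by rewrite mem_facel.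
- rewrite faceI; apply/setP => -[j|G].
    by rewrite in_setD1 !mem_facel !inE andbCA andbb.
  rewrite in_setD1 !mem_facer !inE /=.
  by case GC: (G \in C); rewrite //= (subsetP CB) ?orbT.
- rewrite faceI faceS; apply/andP; split.
    by rewrite subsetD1 subsetIl inE (negPf iJ) andbF.
  by rewrite subIset // (subset_trans CB) ?subsetUr.
Qed.

Lemma shellable_upper_augmented :
  (forall F, proper_flat f F -> shellable (upper_complex F)) ->
  exists ss, shelling_order (augmented_bergman f) ss /\ flags_first_bases_last ss.
Proof.
case/augmented_shelling_rank => r rK r_basis.
have ssP := shelling_order_sort rK; eexists; split; first exact: ssP.
set ss := sort _ _ in ssP *.
have: pairwise (relpre r leq) ss.
  rewrite -sorted_pairwise; last by move=> ? ? ?; apply: leq_trans.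
  by apply: sort_sorted => s t; apply: leq_total.
apply: (@sub_in_pairwise _ (mem (facets (augmented_bergman f)))); last first.
  by apply/allP => s; have [_ -> _] := ssP.
move=> s t sF tF /r_basis.
have [I [C [-> If CP]]] := facet_face sF.
have [J [D [-> Jf DP]]] := facet_face tF.
rewrite !y_part_face !x_part_face => IJ; apply/andP; split; apply/implyP => /eqP E.
  (* If the empty set does not span, its [basis_rank] is 0, which forces [I] to be empty; if it
     spans, it is the only independent set. *)
  subst J; have [f0|f0] := eqVneq (f set0) setT.
    by rewrite (independent_span_inj If (sub0set I)) // f0 subsetT.
  by move: IJ; rewrite /basis_rank (negPf f0) cards0 leqn0 addn_eq0 cards_eq0 => /andP[].
(* A spanning [I] has [basis_rank] above [#|T|], which no non-spanning [J] reaches. *)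
subst C; have fIT : f I == setT by case: eqP CP => // _ [] ; rewrite inE.
case: eqP DP => [_ ->//|fJT _]; move: IJ; rewrite /basis_rank fIT mul1n.
case: eqP => // _; rewrite mul0n addn0 => IJ.
by have := leq_trans (leq_addl _ _) IJ; rewrite ltnNge max_card.
Qed.

(** A face containing the vertex [f set0] has a y-part inside [f set0], hence an empty one by
    independence; its link is thus the Bergman complex. *)
Lemma shellable_augmented_bergman :
  shellable (augmented_bergman f) -> shellable (bergman f).
Proof.
have [f0T aug|f0T] := eqVneq (f set0) setT.
  (* Here the vertex is missing, but the empty face is the only face of the Bergman complex, so
     there are no two distinct facets. *)
  apply/shellableP; exists (fun=> 0) => a b /facetsP[aU _] /facetsP[bU _] /eqP[].
  have empty C : C \in upper_complex (f set0) -> C = set0.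
    case/upperP=> _ CF; apply/setP => G; rewrite inE; apply/negP => /CF[_].
    by rewrite f0T properE subsetT subTset andbC; case: eqP.
  by rewrite (empty a aU) (empty b bU).
apply: (@shellable_link _ _ _ _ inr [set inr (f set0)]).
- by move=> ? ? _ _ [].
- move=> C /upperP[_ CF]; rewrite disjoints1; apply/imsetP => -[G + [GE]].
  by rewrite -GE => /CF[_]; rewrite properxx.
- move=> C /upperP[CC CF].
  have -> : [set inr (f set0)] :|: inr @: C = face set0 (f set0 |: C).
    by rewrite /face imset0 set0U imsetU1.
  apply/augmented_bergmanP; split.
  + by apply/forall_inP => i; rewrite inE.
  + by apply: chainU1 => // G /CF[_ /proper_sub->].
  + move=> G /setU1P[->|/CF[Gp /proper_sub//]].
    by rewrite /proper_flat /flat ff eqxx.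
move=> s; rewrite -(face_parts s); move: (y_part s) (x_part s) => I C.
case/augmented_bergmanP=> If CC CF; rewrite sub1set mem_facer => f0C.
have [_ fI0] := CF _ f0C; have IE := independent_span_inj If (sub0set I) fI0.
subst I; exists (C :\ f set0); last first.
  by rewrite /face imset0 set0U -imsetU1 setD1K.
apply/upperP; split; first by apply: (chainS _ CC); apply: subD1set.
by move=> G /setD1P[G0 /CF[Gp fG]]; rewrite properEneq eq_sym G0.
Qed.

End ClosureComplexes.

(** * Equivalence of the four shellability conditions *)

Theorem theorem1p2 (E : finType) (f : {set E} -> {set E})
    (hf : closure_operator f) :
  [<-> shellable (bergman f);
       forall F : {set E}, proper_flat f F ->
         shellable (bergman (@contraction E f F));
       exists ss, shelling_order (augmented_bergman f) ss
                  /\ flags_first_bases_last ss;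
       shellable (augmented_bergman f)].
Proof.
tfae.
- move=> bergman_sh F Fp; have [F_flat _] := andP Fp.
  by apply/(shellable_contraction hf F_flat); apply: shellable_upper.
- move=> contraction_sh; apply: shellable_upper_augmented => // F Fp.
  have [F_flat _] := andP Fp.
  by apply/(shellable_contraction hf F_flat); apply: contraction_sh.
- by case=> ss [ssP _]; exists ss.
- exact: shellable_augmented_bergman.
Qed.
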